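(* Let $D$ be a squarefree integer with $D \not\equiv 1 \pmod 4$ and let $K = \mathbb{Q}(\sqrt{D})$. Then the planar lattice $\Omega_K = \Sigma_K(\mathcal{O}_K)$ is an equal covering extension of the rank-one lattice $\mathbb{Z}\,\Sigma_K(1 + \sqrt{D})$.
   Context: For the quadratic number field $K = \mathbb{Q}(\sqrt{D})$ with embeddings $\sigma_1, \sigma_2 : K \to \mathbb{C}$ (here $\sigma_1$ is the one sending $\sqrt{D}$ to $\sqrt{D}$, respectively to $i\sqrt{|D|}$ if $D<0$), the Minkowski embedding $\Sigma_K : K \to \mathbb{R}^2$ is defined by $\Sigma_K(x) = (\sigma_1(x), \sigma_2(x))^\top$ if $D > 0$, and $\Sigma_K(x) = (\Re(\sigma_1(x)), \Im(\sigma_1(x)))^\top$ if $D < 0$. $\mathcal{O}_K$ is the ring of integers of $K$ and $\Omega_K := \Sigma_K(\mathcal{O}_K)$. The covering radius of a lattice is $\mu(\Lambda) = \min\{ r \in \mathbb{R} : \Lambda + B(r) = \operatorname{span}_{\mathbb{R}}\Lambda\}$, where $B(r)$ is the closed ball of radius $r$ centered at the origin in $\operatorname{span}_{\mathbb{R}}\Lambda$. If $L \subset \Lambda$ is a sublattice of smaller rank, $\Lambda$ is an equal covering extension of $L$ if $\Lambda \cap \operatorname{span}_{\mathbb{R}} L = L$ and $\mu(\Lambda) = \mu(L)$. *)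

(* Defs.v *)
From HB Require Import structures.
From mathcomp Require Import all_boot all_order all_algebra all_field.
From mathcomp Require Import complex.
From mathcomp Require Import classical_sets reals.

Set Implicit Arguments.
Unset Strict Implicit.
Unset Printing Implicit Defensive.

Import Order.TTheory GRing.Theory Num.Theory.

Local Open Scope classical_set_scope.
Local Open Scope ring_scope.

(* 0 is not squarefree, whereas 1 and -1 are. *)
Definition squarefree_int (D : int) : Prop :=
  forall d : int, (d ^+ 2 %| D)%Z -> `|d| = 1.

Section Lattices.

Variables (R : realType) (d : nat).

(* The canonical norm of MathComp-Analysis on matrices is the sup norm, hence
   this explicit Euclidean norm. *)
Definition euclidean_norm (v : 'cV[R]_d) : R :=
  Num.sqrt (\sum_i v i 0 ^+ 2).

Definition real_span (A : set 'cV[R]_d) : set 'cV[R]_d :=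
  [set v | exists (n : nat) (c : 'I_n -> R) (u : 'I_n -> 'cV[R]_d),
     (forall i, A (u i)) /\ v = \sum_i c i *: u i].

(* The columns of B are a Z-basis: they are R-linearly independent and A is the
   set of their integral combinations. *)
Definition lattice_of_rank (n : nat) (A : set 'cV[R]_d) : Prop :=
  exists B : 'M[R]_(d, n),
    \rank B = n /\
    A = [set B *m map_mx intr z | z in [set: 'cV[int]_n]].

Definition span_ball (A : set 'cV[R]_d) (r : R) : set 'cV[R]_d :=
  [set v | real_span A v /\ euclidean_norm v <= r].

Definition covering_radii (A : set 'cV[R]_d) : set R :=
  [set r | [set x + y | x in A & y in span_ball A r] = real_span A].

(* "mu(A) = r": being a relation, it includes the existence of the minimum. *)
Definition is_covering_radius (A : set 'cV[R]_d) (r : R) : Prop :=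
  covering_radii A r /\ lbound (covering_radii A) r.

Definition equal_covering_extension (A L : set 'cV[R]_d) : Prop :=
  [/\ exists m n : nat,
        [/\ lattice_of_rank m L, lattice_of_rank n A & (m < n)%N],
      L `<=` A,
      A `&` real_span L = L
    & exists r : R, is_covering_radius A r /\ is_covering_radius L r].

Definition int_multiples (v : 'cV[R]_d) : set 'cV[R]_d :=
  [set v *~ k | k in [set: int]].

End Lattices.

Section QuadraticFields.

Variable R : realType.

Definition sqrt_int (D : int) : R[i] :=
  if 0 <= D then Complex (Num.sqrt D%:~R) 0
  else Complex 0 (Num.sqrt `|D|%:~R).

Definition ring_of_integers (K : fieldExtType rat) : set K :=
  [set x | integralOver (intr : int -> K) x].

(* When 0 < D both embeddings of Q(sqrt D) are real-valued, so that taking real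
   parts there only changes the type. *)
Definition minkowski_embedding (D : int) (K : fieldExtType rat)
    (sigma1 sigma2 : K -> R[i]) (x : K) : 'cV[R]_2 :=
  if 0 < D
  then \col_(i < 2) (if i == 0 then complex.Re (sigma1 x) else complex.Re (sigma2 x))
  else \col_(i < 2) (if i == 0 then complex.Re (sigma1 x) else complex.Im (sigma1 x)).

End QuadraticFields.

(* Main.v *)
Require Import Defs.
From HB Require Import structures.
From mathcomp Require Import all_boot all_order all_algebra all_field.
From mathcomp Require Import complex.
From mathcomp Require Import classical_sets reals.
From mathcomp Require Import ring lra zify.

Set Implicit Arguments.
Unset Strict Implicit.
Unset Printing Implicit Defensive.

Import Order.TTheory GRing.Theory Num.Theory.

Local Open Scope classical_set_scope.
Local Open Scope ring_scope.

(** For a squarefree D not congruent to 1 modulo 4 the ring of integers of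
    Q(sqrt D) is Z + Z sqrt D, and the Minkowski embedding sends 1 and sqrt D
    to two nonzero orthogonal vectors: (1, 1) and (sqrt D, - sqrt D) when
    D > 0, (1, 0) and (0, sqrt |D|) when D < 0.  Hence Omega_K is a
    rectangular lattice, and 1 + sqrt D is sent to the diagonal of its
    fundamental rectangle.

    The rest is a fact about boxes in any dimension (box_lattice_diagonal).
    Let B have pairwise orthogonal columns b_j.  Since |B c|^2 is the sum of
    the c_j^2 |b_j|^2, a closest lattice point is found by rounding each
    coordinate separately, and the deepest hole is the centre of the box, all
    of whose coordinates are 1/2; so the covering radius of the lattice is half
    the length of the diagonal (covering_radius_orthogonal).  The same lemma
    applied to the single column B 1 says that the lattice generated by the
    diagonal has covering radius half its length too: the two radii agree.

    The description of the ring of integers (ring_of_integers_quadratic) is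
    the classical one.  If x = p + q sqrt D is integral, its trace 2p and its
    norm p^2 - D q^2 are integral and rational, hence integers; as D is
    squarefree, 2q is an integer as well, and reducing
    (2p)^2 - D (2q)^2 modulo 4 shows that 2p and 2q are even.  Trace and norm
    are computed from the two given embeddings, the second of which must
    negate the image of sqrt D. *)

(** * Lattices with an orthogonal basis *)

Definition integral_combinations (R : realType) (d n : nat) (B : 'M[R]_(d, n)) :
  set 'cV[R]_d := [set B *m map_mx intr z | z in [set: 'cV[int]_n]].

Definition orthogonal_columns (R : realType) (d n : nat) (B : 'M[R]_(d, n)) :=
  is_diag_mx (B^T *m B).

Lemma real_span_integral_combinations (R : realType) (d n : nat)
    (B : 'M[R]_(d, n)) :
  real_span (integral_combinations B) = [set B *m c | c in [set: 'cV[R]_n]].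
Proof.
apply/seteqP; split=> v /=.
  move=> [m [c [u [uP ->]]]].
  pose in_lattice (w : 'cV[R]_d) := exists a : 'cV[R]_n, w = B *m a.
  suff [a ->] : in_lattice (\sum_i c i *: u i) by exists a.
  apply: (big_ind in_lattice).
  - by exists 0; rewrite mulmx0.
  - by move=> _ _ [a ->] [b ->]; exists (a + b); rewrite mulmxDr.
  - move=> i _; have [z _ <-] := uP i.
    by exists (c i *: map_mx intr z); rewrite scalemxAr.
move=> [c _ <-].
exists n, (fun j => c j 0), (fun j => B *m map_mx intr (delta_mx j 0)).
split=> [j|]; first by exists (delta_mx j 0).
rewrite [c in LHS]matrix_sum_delta mulmx_sumr.
apply: eq_bigr => j _; rewrite big_ord1 -scalemxAr; congr (_ *: (_ *m _)).
by apply/matrixP=> k l; rewrite !mxE; case: (_ && _).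
Qed.

(** Pythagoras: the Gram matrix of B is diagonal, so its quadratic form has no
    cross terms and each coordinate can be estimated on its own. *)
Lemma sum_sqr_orthogonal (R : realType) (d n : nat) (B : 'M[R]_(d, n))
    (c : 'cV[R]_n) : orthogonal_columns B ->
  \sum_i (B *m c) i 0 ^+ 2 = \sum_j c j 0 ^+ 2 * (B^T *m B) j j.
Proof.
move=> /diag_mxP [g gE].
transitivity (((B *m c)^T *m (B *m c)) 0 0).
  by rewrite [RHS]mxE; apply: eq_bigr => i _; rewrite [_^T _ _]mxE expr2.
rewrite trmx_mul mulmxA -(mulmxA c^T) gE mxE; apply: eq_bigr => j _.
by rewrite mul_mx_diag !mxE eqxx mulr1n; ring.
Qed.

Lemma gram_diag (R : realType) (d n : nat) (B : 'M[R]_(d, n)) (j : 'I_n) :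
  (B^T *m B) j j = \sum_i B i j ^+ 2.
Proof. by rewrite mxE; apply: eq_bigr => i _; rewrite mxE expr2. Qed.

Lemma gram_diag_ge0 (R : realType) (d n : nat) (B : 'M[R]_(d, n)) (j : 'I_n) :
  0 <= (B^T *m B) j j.
Proof. by rewrite gram_diag; apply: sumr_ge0 => i _; apply: sqr_ge0. Qed.

(** The Gram matrix is diagonal with the nonzero squared lengths of the columns
    as entries; it is invertible, and its rank is at most that of B. *)
Lemma rank_orthogonal_columns (R : realType) (d n : nat) (B : 'M[R]_(d, n)) :
  orthogonal_columns B -> (forall j, col j B != 0) -> \rank B = n.
Proof.
move=> orthoB col_neq0; apply/eqP; rewrite eqn_leq rank_leq_col /=.
suff gram_unit : B^T *m B \in unitmx.
  by rewrite -[leqLHS](mxrank_unit gram_unit) mxrankM_maxr.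
have gram_neq0 j : (B^T *m B) j j != 0.
  apply: contra_neq (col_neq0 j) => gram0; apply/colP=> i.
  move: gram0; rewrite gram_diag => /psumr_eq0P B0; rewrite !mxE.
  by apply/eqP; rewrite -sqrf_eq0 B0 // => k _; apply: sqr_ge0.
have /diag_mxP [g gE] := orthoB.
rewrite unitmxE gE det_diag unitfE; apply/prodf_neq0 => j _.
by have := gram_neq0 j; rewrite gE mxE eqxx mulr1n.
Qed.

Lemma floor_half_near (R : realType) (x : R) :
  (x - (Num.floor (x + 2^-1))%:~R) ^+ 2 <= 2^-1 ^+ 2.
Proof.
have /andP[] := floor_itv (x + 2^-1); rewrite intrD.
set m := _%:~R; move=> ? ?; rewrite -ler_sqrt ?sqr_ge0 // !sqrtr_sqr.
by rewrite [leRHS]ger0_norm ?ler_norml ?invr_ge0 //; lra.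
Qed.

(** The difference of the two sides is m (m - 1), a product of consecutive
    integers. *)
Lemma half_int_far (R : realType) (m : int) :
  2^-1 ^+ 2 <= (2^-1 - m%:~R : R) ^+ 2.
Proof.
have : 0 <= (m * (m - 1))%:~R :> R.
  rewrite ler0z; case: (leP m 0) => ?; nia.
by rewrite intrM intrB; nra.
Qed.

(** Rounding every coordinate to a nearest integer leaves coordinates of
    absolute value at most 1/2, which bounds the radius from above; the centre
    of the box has all coordinates 1/2, at distance at least 1/2 from every
    integer, which bounds it from below.  For n = 1 this is the covering
    radius of the multiples of a single vector. *)
Lemma covering_radius_orthogonal (R : realType) (d n : nat) (B : 'M[R]_(d, n)) :
  orthogonal_columns B ->
  is_covering_radius (integral_combinations B)
    (euclidean_norm (B *m const_mx 2^-1)).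
Proof.
move=> orthoB; split=> [|r].
  rewrite /covering_radii /= real_span_integral_combinations.
  apply/seteqP; split=> v /=.
    move=> [_ [z _ <-] [y []]]; rewrite real_span_integral_combinations.
    move=> [c _ <-] _ <-.
    by exists (map_mx intr z + c) => //; rewrite mulmxDr.
  move=> [c _ <-].
  pose z : 'cV[int]_n := \col_j Num.floor (c j 0 + 2^-1).
  exists (B *m map_mx intr z); first by exists z.
  exists (B *m (c - map_mx intr z)); last by rewrite -mulmxDr addrC subrK.
  split.
    by rewrite real_span_integral_combinations; exists (c - map_mx intr z).
  rewrite /euclidean_norm ler_wsqrtr // !sum_sqr_orthogonal //.
  apply: ler_sum => j _; apply: ler_wpM2r; first exact: gram_diag_ge0.
  by rewrite !mxE floor_half_near.
rewrite /covering_radii /= real_span_integral_combinations => cover.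
have : [set B *m c | c in [set: 'cV[R]_n]] (B *m const_mx 2^-1).
  by exists (const_mx 2^-1).
rewrite -cover => -[_ [z _ <-] [y [_ y_le yE]]]; apply: le_trans y_le.
have -> : y = B *m (const_mx 2^-1 - map_mx intr z).
  by rewrite mulmxBr -yE addrC addKr.
rewrite /euclidean_norm ler_wsqrtr // !sum_sqr_orthogonal //.
apply: ler_sum => j _; apply: ler_wpM2r; first exact: gram_diag_ge0.
by rewrite !mxE half_int_far.
Qed.

(** A column vector is a matrix with one column, so that a rank-one lattice
    falls under the results on integral combinations. *)
Lemma int_multiplesE (R : realType) (d : nat) (v : 'cV[R]_d) :
  int_multiples v = integral_combinations v.
Proof.
apply/seteqP; split=> w /= [k _ <-].
  exists (const_mx k) => //; apply/colP=> i.
  by rewrite !mxE big_ord1 !mxE -scaler_int mxE mulrC.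
exists (k 0 0) => //; apply/colP=> i.
by rewrite !mxE big_ord1 !mxE -scaler_int mxE mulrC.
Qed.

(** Half of the diagonal is both the centre of the box and the midpoint of the
    generator of L, which is why the two covering radii agree.  A lattice
    point on the line of the diagonal has all its coordinates equal, by
    independence of the columns, hence is an integral multiple of the
    diagonal. *)
Lemma box_lattice_diagonal (R : realType) (d n : nat) (B : 'M[R]_(d, n)) :
    (1 < n)%N -> orthogonal_columns B -> (forall j, col j B != 0) ->
  let A := integral_combinations B in
  let L := int_multiples (B *m const_mx 1) in
  [/\ lattice_of_rank n A, lattice_of_rank 1 L & equal_covering_extension A L].
Proof.
move=> n_gt1 orthoB col_neq0 A L.
have rankB := rank_orthogonal_columns orthoB col_neq0.
have B_inj (c e : 'cV[R]_n) : B *m c = B *m e -> c = e.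
  move=> /(congr1 trmx); rewrite !trmx_mul => /row_free_inj /trmx_inj.
  by apply; rewrite /row_free mxrank_tr rankB.
have diagonal_neq0 : (B *m const_mx 1 : 'cV[R]_d) != 0.
  apply/eqP=> B1; have /B_inj /colP : B *m const_mx 1 = B *m (0 : 'cV_n).
    by rewrite B1 mulmx0.
  move=> /(_ (Ordinal (ltnW n_gt1))) /eqP.
  by rewrite !mxE oner_eq0.
have LE : L = integral_combinations (B *m const_mx 1) := int_multiplesE _.
have orthoL : orthogonal_columns (B *m const_mx 1 : 'cV[R]_d).
  by apply/is_diag_mxP=> i j; rewrite !ord1.
have latA : lattice_of_rank n A by exists B.
have latL : lattice_of_rank 1 L.
  exists (B *m const_mx 1); split=> //.
  by apply: rank_orthogonal_columns => // j; rewrite ord1 col_id.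
have subLA : L `<=` A.
  rewrite LE => _ [k _ <-]; exists (const_mx (k 0 0)) => //.
  rewrite -mulmxA; congr (B *m _); apply/colP=> i.
  by rewrite !mxE big_ord1 !mxE mul1r.
split=> //; split=> //.
- by exists 1%N, n.
- apply/seteqP; split=> v.
    move=> [[z _ <-]]; rewrite LE real_span_integral_combinations.
    move=> [c _]; rewrite -mulmxA => /B_inj /colP cz.
    have zE i : c 0 0 = (z i 0)%:~R.
      by have := cz i; rewrite !mxE big_ord1 !mxE mul1r.
    exists (const_mx (z (Ordinal (ltnW n_gt1)) 0)) => //.
    rewrite -mulmxA; congr (B *m _); apply/colP=> i.
    by rewrite !mxE big_ord1 !mxE mul1r -!zE.
  move=> Lv; split; first exact: subLA.
  exists 1%N, (fun=> 1), (fun=> v); split=> //.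
  by rewrite big_ord1 scale1r.
- exists (euclidean_norm (B *m const_mx 2^-1)).
  split; first exact: covering_radius_orthogonal.
  have -> : B *m const_mx 2^-1 = (B *m const_mx 1) *m (const_mx 2^-1 : 'cV[R]_1).
    rewrite -mulmxA; congr (B *m _); apply/colP=> i.
    by rewrite !mxE big_ord1 !mxE mul1r.
  by rewrite LE; apply: covering_radius_orthogonal.
Qed.

(** * The ring of integers of a quadratic field *)

(** The equation satisfied in F has integer coefficients, hence holds in rat
    and carries over to the algebraic numbers, where rational algebraic
    integers are known to be integers. *)
Lemma integral_rat_is_int (F : numFieldType) (q : rat) :
  integralOver (intr : int -> F) (ratr q) -> q \is a Num.int.
Proof.
move=> [p mon_p].
have -> : map_poly (intr : int -> F) p = map_poly ratr (map_poly intr p).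
  by rewrite -map_poly_comp; apply: eq_map_poly => m /=; rewrite ratr_int.
rewrite fmorph_root => root_q.
have : (ratr q : algC) \in Num.int.
  apply: Cint_rat_Aint; first exact: Crat_rat.
  apply: (@root_monic_Aint (map_poly ratr (map_poly intr p))).
  - by rewrite fmorph_root; exact: root_q.
  - by rewrite map_monic; apply: monic_map.
  - by apply/polyOverP=> i; rewrite !coef_map /= ratr_int intr_int.
move=> /intrP [m mE]; apply/intrP; exists m.
by apply: (fmorph_inj (@ratr algC)); rewrite /= mE ratr_int.
Qed.

(** With q in lowest terms the square of its denominator divides D. *)
Lemma int_of_squarefree_mul_sqr (D : int) (q : rat) :
  squarefree_int D -> D%:~R * q ^+ 2 \is a Num.int -> q \is a Num.int.
Proof.
move=> sqfD /intrP [m mE].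
have den2 : (denq q ^+ 2 %| D)%Z.
  have cop : coprimez (denq q ^+ 2) (numq q ^+ 2).
    rewrite coprimez_pexpl // coprimez_pexpr // coprimez_sym.
    exact: coprime_num_den.
  rewrite -(Gauss_dvdzl _ cop); apply/dvdzP; exists m.
  apply: (@intr_inj rat); rewrite [LHS]rmorphM [RHS]rmorphM !rmorphXn /= -mE.
  have -> : (numq q)%:~R = q * (denq q)%:~R.
    by rewrite -[X in X * _]divq_num_den divfK // intr_eq0 denq_neq0.
  by rewrite exprMn mulrA.
apply/intrP; exists (numq q); rewrite -[LHS]divq_num_den.
have := sqfD _ den2; rewrite gtr0_norm ?denq_gt0 // => ->.
by rewrite divr1.
Qed.

(** A squarefree D is not divisible by 4, so D is 2 or 3 modulo 4; squares
    being 0 or 1 modulo 4, the norm form then vanishes modulo 4 only on pairs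
    of even integers. *)
Lemma even_of_norm_mod4 (D m n k : int) :
    squarefree_int D -> (D != 1 %[mod 4])%Z -> m ^+ 2 - D * n ^+ 2 = 4 * k ->
  (2 %| m)%Z && (2 %| n)%Z.
Proof.
move=> sqfD D_mod4 norm4.
have D_mod4_neq0 : (D %% 4)%Z != 0.
  by apply/eqP=> /dvdz_mod0P /(sqfD 2).
have [a [e [DE eE]]] : exists a e, D = 4 * a + e /\ (e = 2 \/ e = 3).
  exists (D %/ 4)%Z, (D %% 4)%Z; lia.
have parity (x : int) : exists y r, x = 2 * y + r /\ (r = 0 \/ r = 1).
  exists (x %/ 2)%Z, (x %% 2)%Z; lia.
have [b [f [mE fE]]] := parity m; have [c [g [nE gE]]] := parity n.
subst; case: eE fE gE norm4 => -> [->|->] [->|->] norm4; rewrite !expr2 in norm4.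
all: lia.
Qed.

(** Horner evaluation at s stays in Q + Q s because s^2 is rational. *)
Lemma quadratic_coordinates (K : fieldExtType rat) (s : K) (D : int) (x : K) :
    s ^+ 2 = D%:~R -> <<1; s>>%VS = fullv ->
  exists p q : rat, x = p%:A + q%:A * s.
Proof.
move=> s_sqr K_gen; have : x \in <<1; s>>%VS by rewrite K_gen memvf.
case/Fadjoin_polyP=> _ /polyOver1P [P ->] ->.
elim/poly_ind: P => [|P c [p [q IH]]].
  by exists 0, 0; rewrite rmorph0 horner0 !scale0r mul0r addr0.
exists (q * D%:~R + c), p.
rewrite rmorphD rmorphM /= map_polyX map_polyC /= hornerMXaddC IH.
rewrite mulrDl -mulrA -expr2 s_sqr scalerDl -scalerA.
have -> : (D%:~R : rat)%:A = D%:~R :> K by rewrite scaler_int.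
rewrite -[q *: D%:~R]mulr_algl; ring.
Qed.

Section RingOfIntegers.

Variables (F : numFieldType) (K : fieldExtType rat) (s : K) (D : int).
Variables sigma tau : {rmorphism K -> F}.
Hypothesis s_sqr : s ^+ 2 = D%:~R.
Hypothesis K_gen : <<1; s>>%VS = fullv.

Lemma rmorph_coordinates (f : {rmorphism K -> F}) (p q : rat) :
  f (p%:A + q%:A * s) = ratr p + ratr q * f s.
Proof.
have fA r : f r%:A = ratr r by rewrite -(fmorph_eq_rat (f \o in_alg K)).
by rewrite rmorphD rmorphM !fA.
Qed.

(** Both embeddings send s to a square root of D, and they would coincide if
    these roots were equal. *)
Lemma conjugate_generator : ~ tau =1 sigma -> tau s = - sigma s.
Proof.
move=> tau_neq; have : (tau s - sigma s) * (tau s + sigma s) == 0.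
  by rewrite -subr_sqr -!rmorphXn s_sqr /= !rmorph_int subrr.
rewrite mulf_eq0 subr_eq0 addr_eq0 => /orP[] /eqP // taus; case: tau_neq => x.
have [p [q ->]] := quadratic_coordinates x s_sqr K_gen.
by rewrite !rmorph_coordinates taus.
Qed.

Hypothesis sqfD : squarefree_int D.
Hypothesis D_mod4 : (D != 1 %[mod 4])%Z.
Hypothesis tau_neq : ~ tau =1 sigma.

(** The sum and the product of the two conjugates of x are the images of its
    trace 2p and of its norm p^2 - D q^2; as 4 times the norm is an integer,
    so is D (2q)^2. *)
Lemma ring_of_integers_quadratic :
  ring_of_integers (K := K) =
  [set a%:~R + b%:~R * s | a in [set: int] & b in [set: int]].
Proof.
apply/seteqP; split=> x /=; last first.
  move=> [a _ [b _ <-]].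
  have int_int (m : int) : integralOver (intr : int -> K) m%:~R.
    exact: integral_id.
  apply: integral_add; first exact: int_int.
  apply: integral_mul; first exact: int_int.
  exists ('X^2 - D%:P); first exact: monicXnsubC.
  by rewrite rmorphB /= map_polyXn map_polyC /= rootE !hornerE s_sqr subrr.
rewrite /ring_of_integers /= => int_x.
have int_conj (f : {rmorphism K -> F}) : integralOver (intr : int -> F) (f x).
  have [P monP rootP] := integral_rmorph f int_x; exists P => //.
  by move: rootP; rewrite (eq_map_poly (g := intr)) // => m /=; rewrite rmorph_int.
have [p [q xE]] := quadratic_coordinates x s_sqr K_gen.
have tauE : tau x = ratr p - ratr q * sigma s.
  by rewrite xE rmorph_coordinates conjugate_generator // mulrN.
have sigmaE : sigma x = ratr p + ratr q * sigma s by rewrite xE rmorph_coordinates.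
have /intrP [m mE] : 2 * p \is a Num.int.
  apply: (@integral_rat_is_int F).
  have -> : ratr (2 * p) = sigma x + tau x :> F.
    by rewrite sigmaE tauE rmorphM /= ratr_nat; ring.
  exact: integral_add.
have /intrP [k kE] : p ^+ 2 - D%:~R * q ^+ 2 \is a Num.int.
  apply: (@integral_rat_is_int F).
  have -> : ratr (p ^+ 2 - D%:~R * q ^+ 2) = sigma x * tau x :> F.
    rewrite sigmaE tauE rmorphB rmorphM !rmorphXn /= ratr_int.
    by rewrite -(rmorph_int sigma) -s_sqr rmorphXn; ring.
  exact: integral_mul.
have /intrP [n nE] : 2 * q \is a Num.int.
  apply: (@int_of_squarefree_mul_sqr D) => //; apply/intrP; exists (m ^+ 2 - 4 * k).
  by rewrite rmorphB rmorphXn rmorphM /= -mE -kE; ring.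
have /andP[/dvdzP [a aE] /dvdzP [b bE]] : (2 %| m)%Z && (2 %| n)%Z.
  apply: (@even_of_norm_mod4 D m n k) => //; apply: (@intr_inj rat).
  by rewrite rmorphB rmorphXn rmorphM rmorphXn rmorphM /= -mE -nE -kE; ring.
have pE : p = a%:~R.
  apply: (@mulfI _ 2); rewrite ?pnatr_eq0 // mE aE rmorphM /=; ring.
have qE : q = b%:~R.
  apply: (@mulfI _ 2); rewrite ?pnatr_eq0 // nE bE rmorphM /=; ring.
by exists a => //; exists b => //; rewrite xE pE qE !scaler_int.
Qed.

End RingOfIntegers.

(** * The Minkowski embedding of Z + Z sqrt D *)

Section MinkowskiEmbedding.

Variables (R : realType) (D : int) (K : fieldExtType rat) (s : K).
Variables sigma1 sigma2 : {rmorphism K -> R[i]}.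
Hypothesis sigma1_s : sigma1 s = sqrt_int R D.
Hypothesis sigma2_s : sigma2 s = - sqrt_int R D.
Hypothesis D_neq0 : D != 0.

Local Notation Sigma := (minkowski_embedding D sigma1 sigma2).

Lemma minkowski_embedding_int (a b : int) (x y : K) :
  Sigma (a%:~R * x + b%:~R * y) = a%:~R *: Sigma x + b%:~R *: Sigma y.
Proof.
have Re_int m (z w : R[i]) :
    complex.Re (z + m%:~R * w) = complex.Re z + m%:~R * complex.Re w.
  by rewrite -(rmorph_int (real_complex R)); case: z w => [? ?] [? ?] /=; ring.
have Im_int m (z w : R[i]) :
    complex.Im (z + m%:~R * w) = complex.Im z + m%:~R * complex.Im w.
  by rewrite -(rmorph_int (real_complex R)); case: z w => [? ?] [? ?] /=; ring.
rewrite /minkowski_embedding -[a%:~R * x]add0r.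
by case: ifP => _; apply/colP=> i; rewrite !mxE; case: ifP => _;
  rewrite !rmorphD !rmorphM !rmorph_int rmorph0 ?Re_int ?Im_int add0r.
Qed.

Definition minkowski_basis : 'M[R]_2 :=
  \matrix_(i, j) Sigma (if j == 0 then 1 else s) i 0.

Lemma minkowski_basisE (a b : int) :
  Sigma (a%:~R + b%:~R * s) =
  minkowski_basis *m map_mx intr (\col_j if j == 0 then a else b).
Proof.
rewrite -[a%:~R]mulr1 minkowski_embedding_int; apply/colP=> i.
by rewrite !mxE big_ord_recl big_ord1 !mxE /=; congr (_ + _); rewrite mulrC.
Qed.

(** The scalar product of the two columns is sqrt D - sqrt D when D > 0; when
    D < 0 the columns lie on the two coordinate axes. *)
Lemma minkowski_basis_orthogonal : orthogonal_columns minkowski_basis.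
Proof.
apply/is_diag_mxP=> i j.
suff orth : \sum_k Sigma 1 k 0 * Sigma s k 0 = 0.
  case: i j => [[|[|//]] ?] [[|[|//]] ?] // _; rewrite mxE -[RHS]orth;
    apply: eq_bigr => k _; rewrite !mxE //=; exact: mulrC.
rewrite big_ord_recl big_ord1 /minkowski_embedding sigma1_s sigma2_s !rmorph1.
rewrite /sqrt_int.
by case: (ltgtP D 0) D_neq0 => //= _ _; rewrite !mxE /=; ring.
Qed.

Lemma minkowski_basis_col_neq0 (j : 'I_2) : col j minkowski_basis != 0.
Proof.
have Sigma_neq0 : Sigma 1 != 0 /\ Sigma s != 0.
  rewrite /minkowski_embedding sigma1_s sigma2_s !rmorph1 /sqrt_int.
  have sqrt_neq0 : Num.sqrt `|D|%:~R != 0 :> R.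
    by rewrite sqrtr_eq0 -ltNge ltr0z normr_gt0.
  split.
    apply/eqP=> /colP /(_ 0); case: ifP => _; rewrite !mxE /= => /eqP;
      by rewrite oner_eq0.
  case: (ltgtP D 0) D_neq0 sqrt_neq0 => //= D_sgn _.
    by move=> ?; apply/eqP=> /colP /(_ 1); rewrite !mxE /=; apply/eqP.
  rewrite gtr0_norm // => ?.
  by apply/eqP=> /colP /(_ 0); rewrite !mxE /=; apply/eqP.
have -> : col j minkowski_basis = Sigma (if j == 0 then 1 else s).
  by apply/colP=> i; rewrite !mxE.
by case: ifP => _; case: Sigma_neq0.
Qed.

End MinkowskiEmbedding.

(* K = Q(s) with s the square root of D; sigma1 and sigma2 are its two complex
   embeddings. *)
Theorem corollary5p4 (R : realType) (D : int)
    (D_squarefree : squarefree_int D)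
    (D_mod4 : (D != 1 %[mod 4])%Z)
    (K : fieldExtType rat) (s : K)
    (s_sqr : s ^+ 2 = D%:~R)
    (K_gen : <<1; s>>%VS = fullv)
    (sigma1 sigma2 : {rmorphism K -> R[i]})
    (sigma1_s : sigma1 s = sqrt_int R D)
    (sigma2_neq : ~ (sigma2 =1 sigma1)) :
  let Sigma := minkowski_embedding D sigma1 sigma2 in
  let Omega := Sigma @` (ring_of_integers (K := K)) in
  let L := int_multiples (Sigma (1 + s)) in
  [/\ lattice_of_rank 2 Omega,
      lattice_of_rank 1 L
    & equal_covering_extension Omega L].
Proof.
move=> Sigma Omega L.
have D_neq0 : D != 0.
  by apply/eqP=> D0; have := D_squarefree 2; rewrite D0 dvdz0 => /(_ isT).
have sigma2_s : sigma2 s = - sqrt_int R D.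
  by rewrite -sigma1_s; apply: conjugate_generator s_sqr K_gen _.
pose B := minkowski_basis D s sigma1 sigma2.
have OmegaE : Omega = integral_combinations B.
  rewrite /Omega.
  rewrite (ring_of_integers_quadratic s_sqr K_gen D_squarefree D_mod4 sigma2_neq).
  apply/seteqP; split=> v /=.
    move=> [_ [a _ [b _ <-]] <-]; exists (\col_j if j == 0 then a else b) => //.
    by rewrite /Sigma minkowski_basisE.
  move=> [z _ <-]; exists ((z 0 0)%:~R + (z 1 0)%:~R * s).
    by exists (z 0 0) => //; exists (z 1 0).
  rewrite /Sigma minkowski_basisE; congr (_ *m map_mx _ _).
  apply/colP=> j; rewrite mxE.
  by case: j => [[|[|//]] ?] /=; congr (z _ _); apply/val_inj.
have LE : L = int_multiples (B *m const_mx 1).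
  rewrite /L /Sigma; congr int_multiples.
  have := minkowski_basisE D s sigma1 sigma2 1 1; rewrite mul1r => ->.
  by congr (_ *m _); apply/colP=> j; rewrite !mxE if_same.
rewrite OmegaE LE; apply: box_lattice_diagonal => //.
  exact: minkowski_basis_orthogonal.
exact: minkowski_basis_col_neq0.
Qed.
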